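(* Let $f_1,f_2,f_3$ be power spectral density functions on $[-\pi,\pi)$ with $\log f_i\in L_1[-\pi,\pi)$ for $i\in\{1,2,3\}$. Then: (i) $\delta_{a/g}(f_1,f_2)\in\mathbb{R}_+\cup\{\infty\}$, where $\mathbb{R}_+=[0,\infty)$. (ii) $\delta_{a/g}(f_1,f_2)=0$ if and only if $f_1(\theta)/f_2(\theta)$ is constant (almost everywhere). (iii) For each $b\in\{2,3\}$, $\delta_{a/g}(f_1,f_{\tau,1,b})$ is monotonically increasing (i.e. nondecreasing) as a function of $\tau\in[0,1]$. (iv) $\delta_{a/g}(f_1,f_{\tau,2,3})$ is convex as a function of $\tau\in[0,1]$.
   Context: A power spectral density function is a nonnegative integrable function on $[-\pi,\pi)$; functions are identified when equal almost everywhere. For density functions $f,g$ with $\log f,\log g\in L_1[-\pi,\pi)$ define $$\delta_{a/g}(f,g):=\log\left(\frac{1}{2\pi}\int_{-\pi}^{\pi}\frac{f(\theta)}{g(\theta)}\,d\theta\right)-\frac{1}{2\pi}\int_{-\pi}^{\pi}\log\left(\frac{f(\theta)}{g(\theta)}\right)d\theta ,$$ with value $+\infty$ if $f/g$ is not integrable. For density functions $f_a,f_b$, the logarithmic interval between them is $f_{\tau,a,b}:=f_a^{1-\tau}f_b^{\tau}$, $\tau\in[0,1]$. Convexity and monotonicity are understood for functions with values in $[0,\infty]$. *)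

(* Defs.v *)
From HB Require Import structures.
From mathcomp Require Import all_boot all_order all_algebra.
From mathcomp Require Import all_classical all_reals all_analysis.
Set Implicit Arguments.
Unset Strict Implicit.
Unset Printing Implicit Defensive.
Import Order.TTheory GRing.Theory Num.Theory.
Import numFieldNormedType.Exports.
Local Open Scope classical_set_scope.
Local Open Scope ring_scope.

(* Functions on [-pi, pi) are represented by functions
   R -> R of which only the values on [circle R] are used. *)

Definition circle (R : realType) : set R := [set` `[- pi, pi[%R].

(* Nonnegativity is required almost everywhere only, as functions are
   identified when equal almost everywhere. *)
Definition psd (R : realType) (f : R -> R) : Prop :=
  (@lebesgue_measure R).-integrable (@circle R) (EFin \o f) /\
  {ae @lebesgue_measure R, forall x, circle x -> 0 <= f x}.

(* The extended logarithm [lne] is used because [ln 0 = 0] whereas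
   [lne 0 = -oo]: with [lne], integrability forces f > 0 almost everywhere. *)
Definition log_fun (R : realType) (f : R -> R) (x : R) : \bar R :=
  lne (f x)%:E.

Definition log_L1 (R : realType) (f : R -> R) : Prop :=
  (@lebesgue_measure R).-integrable (@circle R) (log_fun f).

Definition circle_mean (R : realType) (h : R -> \bar R) : \bar R :=
  ((2 * pi)^-1%:E * \int[@lebesgue_measure R]_(x in @circle R) h x)%E.

Definition delta_ag (R : realType) (f g : R -> R) : \bar R :=
  let q := (fun x => f x / g x) in
  if `[< (@lebesgue_measure R).-integrable (@circle R) (EFin \o q) >]
  then (lne (circle_mean (EFin \o q)) - circle_mean (log_fun q))%E
  else +oo%E.

Definition log_interval (R : realType) (fa fb : R -> R) (tau : R) : R -> R :=
  fun x => fa x `^ (1 - tau) * fb x `^ tau.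

(* The library's [convex_function] only covers real-valued functions. For F
   with values in [0, +oo], the convention 0 * +oo = 0 makes the inequality
   trivial at l = 0 and l = 1. *)
Definition ereal_convex_on (R : realType) (D : set R) (F : R -> \bar R) :
    Prop :=
  forall s t l : R, D s -> D t -> 0 <= l <= 1 ->
    (F ((1 - l) * s + l * t)%R <= (1 - l)%:E * F s + l%:E * F t)%E.

(* Main.v *)
(* Writing f / g = exp h with h = log f - log g integrable, delta_{a/g}(f, g)
   equals log (mean (exp h)) - mean h. It is nonnegative by Jensen's inequality,
   obtained by integrating the tangent exp (mean h) (1 + h - mean h) <= exp h,
   and vanishes only if this tangent inequality is an equality almost
   everywhere, that is, if h is constant. It is convex in h (Hoelder's
   inequality), and along a logarithmic interval h is affine in tau, whence
   (iv). For (iii), the convex function of tau is nonnegative and vanishes at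
   tau = 0. *)
Require Import Defs.
From mathcomp Require Import all_boot all_order all_algebra.
From mathcomp Require Import all_classical all_reals all_analysis.
From mathcomp Require Import measurable_realfun ring lra.
Import Order.TTheory GRing.Theory Num.Theory.
Local Open Scope classical_set_scope.
Local Open Scope ring_scope.

(** * Means over a set of finite positive measure *)

Section mean_on_finite_measure_set.
Set Implicit Arguments.
Unset Strict Implicit.
Unset Printing Implicit Defensive.
Context {d : measure_display} {T : measurableType d} {R : realType}.
Context (mu : {measure set T -> \bar R}) (D : set T).
Context (mD : measurable D) (m : R) (m0 : 0 < m) (muD : mu D = m%:E).
Local Notation integrableR h := (mu.-integrable D (EFin \o h)).

Definition mean (h : T -> R) : R := m^-1 * \int[mu]_(x in D) h x.

Lemma integrableR_cst (c : R) : integrableR (fun=> c).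
Proof.
apply: measurable_bounded_integrable => //; first by rewrite muD ltry.
by exists `|c|; split; rewrite ?num_real// => y cy x _; exact: ltW.
Qed.

Lemma integrableR_add (h k : T -> R) :
  integrableR h -> integrableR k -> integrableR (fun x => h x + k x).
Proof. by move=> ih ik; have := integrableD mD ih ik. Qed.

Lemma integrableR_scale (c : R) (h : T -> R) :
  integrableR h -> integrableR (fun x => c * h x).
Proof. by move=> ih; have := integrableZl mD c ih. Qed.

Lemma mean_cst (c : R) : mean (fun=> c) = c.
Proof. by rewrite /mean Rintegral_cst// muD/= mulrC mulfK// gt_eqF. Qed.

Lemma mean_add (h k : T -> R) : integrableR h -> integrableR k ->
  mean (fun x => h x + k x) = mean h + mean k.
Proof. by move=> ih ik; rewrite /mean RintegralD// mulrDr. Qed.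

Lemma mean_scale (c : R) (h : T -> R) : integrableR h ->
  mean (fun x => c * h x) = c * mean h.
Proof. by move=> ih; rewrite /mean RintegralZl// mulrCA. Qed.

Lemma le_mean (h k : T -> R) : integrableR h -> integrableR k ->
  (forall x, h x <= k x) -> mean h <= mean k.
Proof.
move=> ih ik hk; rewrite /mean ler_pM2l ?invr_gt0//.
by apply: le_Rintegral => // x _; exact: hk.
Qed.

Lemma ae_eq_mean (h k : T -> R) : measurable_fun D h -> measurable_fun D k ->
  {ae mu, forall x, D x -> h x = k x} -> mean h = mean k.
Proof.
move=> mh mk hk; rewrite /mean /Rintegral; congr (_ * fine _).
apply: ae_eq_integral => //; [exact/measurable_EFinP..|].
by apply: filterS hk => x + Dx => ->.
Qed.

Lemma ae_eq_integrableR (h k : T -> R) : measurable_fun D k ->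
  {ae mu, forall x, D x -> h x = k x} -> integrableR h -> integrableR k.
Proof.
move=> mk hk ih; have mh := measurable_int mu ih.
have mk' : measurable_fun D (EFin \o k) by exact/measurable_EFinP.
apply/integrableP; split=> //; have /integrableP[_] := ih.
rewrite (@ae_eq_integral _ _ _ _ _ (fun x => `|(k x)%:E|%E))//.
- exact: measurableT_comp.
- exact: measurableT_comp.
- by apply: filterS hk => x + Dx => /= ->.
Qed.

Lemma ge0_mean_eq0 (h : T -> R) : integrableR h -> (forall x, 0 <= h x) ->
  mean h = 0 -> {ae mu, forall x, D x -> h x = 0}.
Proof.
move=> ih h0 /eqP; rewrite mulf_eq0 invr_eq0 gt_eqF//= => /eqP ih0.
have int0 : (\int[mu]_(x in D) `|(h x)%:E| = 0)%E.
  under eq_integral do rewrite gee0_abs ?lee_fin//.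
  rewrite -[LHS]fineK; first by rewrite -/(Rintegral _ _ _) ih0.
  exact: integrable_fin_num.
have /(ae_eq_integral_abs mu mD) := int0.
move/(_ (measurable_int mu ih)); apply: filterS => x + Dx.
by move=> /(_ Dx) [].
Qed.

(* With h = log (f / g), this is the divergence delta_{a/g}(f, g). *)
Definition exp_gap (h : T -> R) : \bar R :=
  if `[< integrableR (expR \o h) >]
  then (ln (mean (expR \o h)) - mean h)%:E else +oo%E.

(** * Tangent and convexity inequalities for the exponential *)

Lemma expR_tangent (x y : R) : expR y * (1 + (x - y)) <= expR x.
Proof.
rewrite -[in leRHS](subrK y x) [_ - y + y]addrC expRD ler_pM2l ?expR_gt0//.
exact: expR_ge1Dx.
Qed.

Lemma expR_tangent_eq (x y : R) : expR x = expR y * (1 + (x - y)) -> x = y.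
Proof.
move=> e; apply/eqP; rewrite -subr_eq0; apply: contraPT e => xy.
apply/eqP; rewrite gt_eqF// -[in ltRHS](subrK y x) [_ - y + y]addrC expRD ltr_pM2l ?expR_gt0//.
exact: expR_gt1Dx.
Qed.

(** In the weighted sum of the tangent inequalities at the point [z] the linear terms cancel, since
    [z] is the weighted mean of [x] and [y]. *)
Lemma expR_convex (l x y : R) : 0 <= l <= 1 ->
  expR ((1 - l) * x + l * y) <= (1 - l) * expR x + l * expR y.
Proof.
move=> /andP[l0 l1]; set z := _ + _.
have -> : expR z = (1 - l) * (expR z * (1 + (x - z))) +
    l * (expR z * (1 + (y - z))) by rewrite /z; ring.
by rewrite lerD// ler_wpM2l ?subr_ge0// expR_tangent.
Qed.

(** Pointwise form of Hoelder's inequality: convexity applied to [x - ln a] and [y - ln b]. When [a]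
    and [b] are the means of exp h and exp k, the bound taken at [x = h] and [y = k] has mean
    a^(1-l) b^l. *)
Lemma expR_convex_scaled (l x y a b : R) : 0 <= l <= 1 -> 0 < a -> 0 < b ->
  expR ((1 - l) * x + l * y) <= expR ((1 - l) * ln a + l * ln b) *
    ((1 - l) / a * expR x + l / b * expR y).
Proof.
move=> l01 a0 b0; set c := _ + l * ln b.
rewrite (_ : _ + l * y = c + ((1 - l) * (x - ln a) + l * (y - ln b))); last first.
  by rewrite /c; ring.
rewrite expRD ler_pM2l ?expR_gt0// (le_trans (expR_convex _ _ l01))//.
by rewrite !expRB (lnK a0) (lnK b0) !mulrA ![_ * expR _ / _]mulrAC.
Qed.

(** * Jensen's inequality, its equality case, and convexity of the gap *)

Lemma integrableR_tangent (h : T -> R) (a : R) : integrableR h ->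
  integrableR (fun x => expR a * (1 + (h x - a))).
Proof.
move=> ih; apply/integrableR_scale/integrableR_add; first exact: integrableR_cst.
by apply: integrableR_add => //; exact: integrableR_cst.
Qed.

Lemma mean_tangent (h : T -> R) : integrableR h ->
  mean (fun x => expR (mean h) * (1 + (h x - mean h))) = expR (mean h).
Proof.
move=> ih; have ic := integrableR_cst.
rewrite mean_scale ?mean_add ?mean_cst ?subrr ?addr0 ?mulr1//.
- exact: integrableR_add.
- by do 2 apply: integrableR_add => //.
Qed.

Lemma jensen_expR (h : T -> R) : integrableR h -> integrableR (expR \o h) ->
  expR (mean h) <= mean (expR \o h).
Proof.
move=> ih ie; rewrite -{1}(mean_tangent ih); apply: le_mean => //.
- exact: integrableR_tangent.
- by move=> x; exact: expR_tangent.
Qed.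

Lemma exp_gap_ge0 (h : T -> R) : integrableR h -> (0 <= exp_gap h)%E.
Proof.
move=> ih; rewrite /exp_gap; case: asboolP => [ie|_]; last exact: leey.
rewrite lee_fin subr_ge0 -ler_expR lnK; first exact: jensen_expR.
by rewrite posrE (lt_le_trans _ (jensen_expR ih ie))// expR_gt0.
Qed.

Lemma ae_eq_exp_gap (h k : T -> R) : measurable_fun D h ->
  measurable_fun D k -> {ae mu, forall x, D x -> h x = k x} ->
  exp_gap h = exp_gap k.
Proof.
move=> mh mk hk.
have mE (f : T -> R) : measurable_fun D f -> measurable_fun D (expR \o f).
  by move=> mf; exact: measurableT_comp.
have ehk : {ae mu, forall x, D x -> (expR \o h) x = (expR \o k) x}.
  by apply: filterS hk => x + Dx => /= ->.
have ekh : {ae mu, forall x, D x -> (expR \o k) x = (expR \o h) x}.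
  by apply: filterS hk => x + Dx => /= ->.
have ihk : integrableR (expR \o h) <-> integrableR (expR \o k).
  by split; apply: ae_eq_integrableR => //; exact: mE.
rewrite /exp_gap (asbool_equiv_eq ihk).
by rewrite (ae_eq_mean (mE h mh) (mE k mk) ehk) (ae_eq_mean mh mk hk).
Qed.

Lemma exp_gap_cst (c : R) : exp_gap (fun=> c) = 0%E.
Proof.
rewrite /exp_gap (_ : expR \o _ = fun=> expR c)//.
by rewrite asboolT ?mean_cst ?expRK ?subrr//; exact: integrableR_cst.
Qed.

Lemma exp_gap_eq0 (h : T -> R) : integrableR h -> exp_gap h = 0%E ->
  {ae mu, forall x, D x -> h x = mean h}.
Proof.
move=> ih; rewrite /exp_gap; case: asboolP => // ie [] /eqP.
rewrite subr_eq0 => /eqP lnE.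
have eE : mean (expR \o h) = expR (mean h).
  rewrite -lnE lnK// posrE (lt_le_trans _ (jensen_expR ih ie))//.
  exact: expR_gt0.
have it := integrableR_tangent (mean h) ih.
have iNt := integrableR_scale (-1) it.
(* Exp h minus its tangent at [mean h] is nonnegative, and its mean is zero because both terms have
   mean [expR (mean h)]. *)
have /ge0_mean_eq0 := integrableR_add ie iNt.
rewrite (mean_add ie iNt) (mean_scale _ it) mean_tangent// eE mulN1r subrr.
have h0 x : 0 <= (expR \o h) x + -1 * (expR (mean h) * (1 + (h x - mean h))).
  by rewrite mulN1r subr_ge0 expR_tangent.
move=> /(_ h0 erefl); apply: filterS => x + Dx => /(_ Dx)/eqP.
by rewrite mulN1r subr_eq0 => /eqP /expR_tangent_eq.
Qed.

Lemma exp_gap_convex (h k : T -> R) (l : R) :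
  integrableR h -> integrableR k -> 0 <= l <= 1 ->
  (exp_gap (fun x => (1 - l) * h x + l * k x)%R
    <= (1 - l)%:E * exp_gap h + l%:E * exp_gap k)%E.
Proof.
move=> ih ik l01; have /andP[l0 l1] := l01.
(* The endpoints are separate: there the function of weight zero may have a non-integrable
   exponential, and the convention 0 * +oo = 0 makes both sides equal. *)
have [->|l_neq0] := eqVneq l 0.
  rewrite subr0 mul1e mul0e adde0.
  by under [fun x => _]eq_fun do rewrite mul1r mul0r addr0.
have [->|l_neq1] := eqVneq l 1.
  rewrite subrr mul1e mul0e add0e.
  by under [fun x => _]eq_fun do rewrite mul1r mul0r add0r.
have {l_neq0}l_gt0 : 0 < l by rewrite lt_def l_neq0.
have {l_neq1}l_lt1 : 0 < 1 - l by rewrite subr_gt0 lt_def eq_sym l_neq1.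
have gap_h0 := exp_gap_ge0 ih; have gap_k0 := exp_gap_ge0 ik.
move: gap_h0 gap_k0.
(* Both weights are now positive, so an infinite gap makes the right side +oo; nonnegativity of the
   other gap rules out a sum of +oo and -oo. *)
rewrite [exp_gap h]/exp_gap; case: asboolP => [eh|_ _ k0]; last first.
  rewrite gt0_muley ?lte_fin// addye ?leey//.
  by rewrite gt_eqF// (lt_le_trans ltNy0)// mule_ge0// lee_fin.
rewrite [exp_gap k]/exp_gap; case: asboolP => [ek|_ h0 _]; last first.
  by rewrite (gt0_muley (_ : 0 < l%:E)%E) ?lte_fin// addey ?leey.
move=> _ _.
have [A AE] : exists A, mean (expR \o h) = A by eexists.
have [B BE] : exists B, mean (expR \o k) = B by eexists.
have A0 : 0 < A.
  by rewrite -AE (lt_le_trans _ (jensen_expR ih eh))// expR_gt0.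
have B0 : 0 < B.
  by rewrite -BE (lt_le_trans _ (jensen_expR ik ek))// expR_gt0.
(* [C] is A^(1-l) B^l. The function [q] dominates the exponential of the combination pointwise and
   has mean [C]; this yields both integrability on the left side and Hoelder's bound. *)
pose C := expR ((1 - l) * ln A + l * ln B).
pose q x := C * ((1 - l) / A * expR (h x) + l / B * expR (k x)).
have Hq x : expR ((1 - l) * h x + l * k x) <= q x.
  exact: expR_convex_scaled.
have iq1 : integrableR (fun x => (1 - l) / A * expR (h x)).
  exact: integrableR_scale eh.
have iq2 : integrableR (fun x => l / B * expR (k x)).
  exact: integrableR_scale ek.
have iq : integrableR q by exact/integrableR_scale/integrableR_add.
have iz : integrableR (fun x => (1 - l) * h x + l * k x).
  by apply: integrableR_add; exact: integrableR_scale.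
have ie : integrableR (expR \o (fun x => (1 - l) * h x + l * k x)).
  apply: le_integrable iq => //.
    apply/measurable_EFinP/measurableT_comp => //.
    apply/measurable_EFinP; exact: (measurable_int mu iz).
  move=> x _; rewrite /= lee_fin ger0_norm ?expR_ge0//.
  exact: le_trans (Hq x) (ler_norm _).
have meanq : mean q = C.
  rewrite /q (mean_scale _ (integrableR_add iq1 iq2)) (mean_add iq1 iq2).
  rewrite (mean_scale _ eh) (mean_scale _ ek) AE BE.
  by rewrite (divfK (lt0r_neq0 A0)) (divfK (lt0r_neq0 B0)) subrK mulr1.
rewrite /exp_gap asboolT// AE BE -!EFinM -EFinD lee_fin.
rewrite (mean_add (integrableR_scale _ ih) (integrableR_scale _ ik)).
rewrite (mean_scale _ ih) (mean_scale _ ik).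
have zC : mean (expR \o (fun x => (1 - l) * h x + l * k x)) <= C.
  by rewrite -meanq; exact: le_mean.
have z0 : 0 < mean (expR \o (fun x => (1 - l) * h x + l * k x)).
  exact: lt_le_trans (expR_gt0 _) (jensen_expR iz ie).
(* After taking logarithms the bound by [C] is affine in [ln A] and [ln B], and the means of [h] and
   [k] contribute equally to both sides. *)
rewrite -ler_ln ?posrE ?expR_gt0// expRK in zC.
move: (ln (mean _)) (mean h) (mean k) (ln A) (ln B) zC => c a b u v zC.
by clear -zC; lra.
Qed.

End mean_on_finite_measure_set.

(** * From densities on the circle to the gap of the log ratio *)

Section delta_ag_as_exp_gap.
Set Implicit Arguments.
Unset Strict Implicit.
Unset Printing Implicit Defensive.
Context {R : realType}.
Local Notation mu := (@lebesgue_measure R).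
Local Notation C := (@circle R).
(* Not found by typeclass resolution for [lebesgue_measure]. *)
#[local] Instance ae_lebesgue_filter : Filter (almost_everywhere mu) :=
  ae_filter_ringOfSetsType mu.

Lemma measurable_funV d (T : measurableType d) (D : set T) (f : T -> R) :
  measurable_fun D f -> measurable_fun D (fun x => (f x)^-1).
Proof.
move=> mf.
(* Squaring makes the base nonnegative, so that inversion becomes a real power, whose measurability
   is known; at zeros of [f] both sides are 0. *)
have -> : (fun x => (f x)^-1) = (fun x => f x * (f x ^+ 2) `^ (-1)).
  apply/funext => x; rewrite powR_inv1 ?sqr_ge0//.
  have [->|fx0] := eqVneq (f x) 0; first by rewrite mul0r invr0.
  by rewrite expr2 invfM mulrA mulfV// mul1r.
apply: measurable_funM => //.
apply: (measurableT_comp (measurable_powR _)).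
exact: measurable_funX.
Qed.

Lemma measurable_lne_EFin d (T : measurableType d) (D : set T) (f : T -> R) :
  measurable D -> measurable_fun D f -> measurable_fun D (fun x => lne (f x)%:E).
Proof.
move=> mD mf; apply: measurable_fun_if => //.
- exact: measurable_fun_ler.
- apply/measurable_EFinP/measurableT_comp => //.
  by apply: measurable_funS mf => // x [].
Qed.

Lemma measurable_circle : @measurable _ (measurableTypeR R) C.
Proof. exact: measurable_itv. Qed.
Let mC := measurable_circle.

Lemma lebesgue_measure_circle : mu C = (2 * pi)%:E.
Proof.
rewrite /circle lebesgue_measure_itv/= lte_fin ifT ?gtrN ?pi_gt0//.
by congr EFin; ring.
Qed.
Let muC := lebesgue_measure_circle.

Lemma double_pi_gt0 : 0 < 2 * pi :> R.
Proof. by rewrite mulr_gt0 ?pi_gt0. Qed.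
Let pi20 := double_pi_gt0.

Local Notation mean := (mean mu C (2 * pi)).
Local Notation exp_gap := (exp_gap mu C (2 * pi)).
Local Notation integrableC h := (mu.-integrable C (EFin \o h)).

Lemma circle_meanE (h : R -> R) : integrableC h ->
  circle_mean (EFin \o h) = (mean h)%:E.
Proof.
by move=> ih; rewrite /circle_mean /mean EFinM fineK// integrable_fin_num.
Qed.

(** Both the integrability test and the two means are insensitive to null sets, so [h] may be any
    integrable function that is a logarithm of the ratio almost everywhere. *)
Lemma delta_agE (f g h : R -> R) :
  measurable_fun C f -> measurable_fun C g -> integrableC h ->
  {ae mu, forall x, C x -> f x / g x = expR (h x)} ->
  delta_ag f g = exp_gap h.
Proof.
move=> mf mg ih fgh.
have mh : measurable_fun C h by apply/measurable_EFinP; exact: (measurable_int mu ih).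
have mq : measurable_fun C (fun x => f x / g x).
  by apply: measurable_funM => //; exact: measurable_funV.
have me : measurable_fun C (expR \o h) by exact: measurableT_comp.
have hfg : {ae mu, forall x, C x -> (expR \o h) x = f x / g x}.
  by apply: filterS fgh => x + Cx => ->.
have iE : integrableC (fun x => f x / g x) <-> integrableC (expR \o h).
  by split; exact: ae_eq_integrableR.
rewrite /delta_ag /exp_gap (asbool_equiv_eq iE); case: asboolP => // ie.
rewrite (circle_meanE (iE.2 ie)).
have -> : mean (fun x => f x / g x) = mean (expR \o h) by exact: ae_eq_mean.
rewrite lne_EFin; last first.
  by rewrite (lt_le_trans _ (jensen_expR mC pi20 muC ih ie))// expR_gt0.
rewrite EFinB -(circle_meanE ih) /circle_mean; congr (_ - (_ * _))%E.
apply: ae_eq_integral => //.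
- exact: measurable_lne_EFin.
- exact/measurable_EFinP.
- by apply: filterS fgh => x + Cx; rewrite /log_fun => ->//;
    rewrite lne_EFin ?expR_gt0// expRK.
Qed.

(** * Densities with integrable logarithm and their log ratios *)

Lemma psd_measurable (f : R -> R) : psd f -> measurable_fun C f.
Proof. by move=> [fi _]; apply/measurable_EFinP; exact: (measurable_int mu fi). Qed.

(** An integrable function is finite almost everywhere, while [lne] is -oo at nonpositive
    arguments. *)
Lemma log_L1_gt0 (f : R -> R) : log_L1 f -> {ae mu, forall x, C x -> 0 < f x}.
Proof.
move=> /(integrable_ae mC); apply: filterS => x + Cx => /(_ Cx).
by rewrite /log_fun /lne; case: leP.
Qed.

Lemma log_L1_integrable (f : R -> R) : psd f -> log_L1 f ->
  integrableC (fun x => ln (f x)).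
Proof.
move=> pf lf; have mf := psd_measurable pf.
have mlnf : measurable_fun C (fun x => ln (f x)) by exact: measurableT_comp.
have f0 := log_L1_gt0 lf.
apply/integrableP; split; first exact/measurable_EFinP.
have /integrableP[mlf] := lf.
suff -> : (\int[mu]_(x in C) `|log_fun f x| =
    \int[mu]_(x in C) `|(ln (f x))%:E|)%E by [].
apply: ae_eq_integral => //.
- exact: measurableT_comp.
- by apply: measurableT_comp => //; exact/measurable_EFinP.
- by apply: filterS f0 => x + Cx => /(_ Cx) fx0; rewrite /log_fun lne_EFin.
Qed.

Lemma measurable_log_interval (f g : R -> R) (t : R) :
  measurable_fun C f -> measurable_fun C g ->
  measurable_fun C (log_interval f g t).
Proof.
by move=> mf mg; apply: measurable_funM;
  exact: (measurableT_comp (measurable_powR _)).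
Qed.

Lemma log_ratio_integrable (f g : R -> R) :
  psd f -> psd g -> log_L1 f -> log_L1 g ->
  integrableC (fun x => ln (f x) - ln (g x)).
Proof.
move=> pf pg lf lg.
under [fun x => _]eq_fun do rewrite -mulN1r.
apply: (integrableR_add mC); first exact: log_L1_integrable.
by apply: (integrableR_scale mC); exact: log_L1_integrable.
Qed.

Lemma ae_ratio_expR (f g : R -> R) : log_L1 f -> log_L1 g ->
  {ae mu, forall x, C x -> f x / g x = expR (ln (f x) - ln (g x))}.
Proof.
move=> lf lg; apply: filterS2 (log_L1_gt0 lf) (log_L1_gt0 lg).
by move=> x + + Cx => /(_ Cx) f0 /(_ Cx) g0; rewrite expRB !lnK.
Qed.

Lemma delta_ag_log_ratio (f g : R -> R) :
  psd f -> psd g -> log_L1 f -> log_L1 g ->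
  delta_ag f g = exp_gap (fun x => ln (f x) - ln (g x)).
Proof.
move=> pf pg lf lg; apply: delta_agE; [exact: psd_measurable..| |].
- exact: log_ratio_integrable.
- exact: ae_ratio_expR.
Qed.

(** The log ratio is affine in the parameter: log (f / (g1^(1-t) g2^t)) = (1-t) log (f/g1) + t log
    (f/g2) wherever all three functions are positive. This holds for every real [t]. *)
Lemma delta_ag_log_interval (f g1 g2 : R -> R) (t : R) :
  psd f -> psd g1 -> psd g2 -> log_L1 f -> log_L1 g1 -> log_L1 g2 ->
  let h x := (1 - t) * (ln (f x) - ln (g1 x)) + t * (ln (f x) - ln (g2 x)) in
  integrableC h /\ delta_ag f (log_interval g1 g2 t) = exp_gap h.
Proof.
move=> pf pg1 pg2 lf lg1 lg2 h.
have ih : integrableC h.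
  apply: (integrableR_add mC); apply: (integrableR_scale mC);
    exact: log_ratio_integrable.
split=> //; apply: delta_agE => //; first exact: psd_measurable.
  by apply: measurable_log_interval; exact: psd_measurable.
apply: (filterS3 _ _ (log_L1_gt0 lf) (log_L1_gt0 lg1) (log_L1_gt0 lg2)).
move=> x + + + Cx => /(_ Cx) f0 /(_ Cx) g10 /(_ Cx) g20.
rewrite /log_interval /powR !gt_eqF// -expRD -expRN -{1}(lnK f0) -expRD.
by rewrite /h; congr expR; ring.
Qed.

(** * Nonnegativity, vanishing, convexity and monotonicity of the divergence *)

Lemma delta_ag_ge0 (f g : R -> R) :
  psd f -> psd g -> log_L1 f -> log_L1 g -> (0 <= delta_ag f g)%E.
Proof.
move=> pf pg lf lg; rewrite delta_ag_log_ratio//.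
by apply: (exp_gap_ge0 mC pi20 muC); exact: log_ratio_integrable.
Qed.

Lemma delta_ag_eq0 (f g : R -> R) :
  psd f -> psd g -> log_L1 f -> log_L1 g ->
  delta_ag f g = 0%E <->
    exists c : R, {ae mu, forall x, C x -> f x / g x = c}.
Proof.
move=> pf pg lf lg; rewrite delta_ag_log_ratio//.
have ih := log_ratio_integrable pf pg lf lg.
have fgE := ae_ratio_expR lf lg.
split=> [/(exp_gap_eq0 mC pi20 muC ih) hE|[c fgc]].
  exists (expR (mean (fun x => ln (f x) - ln (g x)))).
  by apply: filterS2 fgE hE => x + + Cx => -> // /(_ Cx) ->.
(* Conversely, the ratio is both [c] and the exponential of the log ratio almost everywhere, so the
   log ratio is [ln c] there and its gap is that of a constant. *)
rewrite -(exp_gap_cst mC pi20 muC (ln c)); apply: ae_eq_exp_gap => //.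
  by apply/measurable_EFinP; exact: (measurable_int mu ih).
apply: filterS2 fgE fgc => x + + Cx => /(_ Cx) e /(_ Cx) fgc.
by rewrite -fgc e expRK.
Qed.

Lemma delta_ag_convex (f g1 g2 : R -> R) :
  psd f -> psd g1 -> psd g2 -> log_L1 f -> log_L1 g1 -> log_L1 g2 ->
  ereal_convex_on setT (fun t => delta_ag f (log_interval g1 g2 t)).
Proof.
move=> pf pg1 pg2 lf lg1 lg2 s t l _ _ l01.
have dE r := delta_ag_log_interval r pf pg1 pg2 lf lg1 lg2.
rewrite !(dE _).2.
have := exp_gap_convex mC pi20 muC (dE s).1 (dE t).1 l01.
(* As the log ratio is affine in the parameter, its value at (1-l) s + l t is the same combination
   of its values at [s] and [t]. *)
by congr (exp_gap _ <= _)%E; apply/funext => x; ring.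
Qed.

Lemma delta_ag_log_interval_ge0 (f g1 g2 : R -> R) (t : R) :
  psd f -> psd g1 -> psd g2 -> log_L1 f -> log_L1 g1 -> log_L1 g2 ->
  (0 <= delta_ag f (log_interval g1 g2 t))%E.
Proof.
move=> pf pg1 pg2 lf lg1 lg2.
have [ih ->] := delta_ag_log_interval t pf pg1 pg2 lf lg1 lg2.
exact: exp_gap_ge0.
Qed.

Lemma delta_ag_log_interval0 (f g : R -> R) :
  psd f -> psd g -> log_L1 f -> log_L1 g ->
  delta_ag f (log_interval f g 0) = 0%E.
Proof.
move=> pf pg lf lg.
have [_ ->] := delta_ag_log_interval 0 pf pf pg lf lf lg.
rewrite -(exp_gap_cst mC pi20 muC 0); congr exp_gap.
by apply/funext => x; ring.
Qed.

(* A nonnegative convex function vanishing at 0 is nondecreasing on [0, +oo[. *)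
Lemma delta_ag_log_interval_homo (f g : R -> R) (s t : R) :
  psd f -> psd g -> log_L1 f -> log_L1 g -> 0 <= s -> s <= t ->
  (delta_ag f (log_interval f g s) <= delta_ag f (log_interval f g t))%E.
Proof.
move=> pf pg lf lg s0 st.
have [t0|t_neq0] := eqVneq t 0.
  by rewrite (_ : s = t)//; apply/eqP; rewrite eq_le st t0.
have t_gt0 : 0 < t by rewrite lt_def t_neq0 (le_trans s0).
have st01 : 0 <= s / t <= 1.
  by rewrite divr_ge0 ?(ltW t_gt0)//= ler_pdivrMr// mul1r.
(* Since [s] is the combination of 0 and [t] with weight [s / t], and the divergence vanishes at 0,
   convexity bounds the value at [s] by [s / t] times the value at [t]; nonnegativity of the latter
   and [s / t <= 1] conclude. *)
have /(_ 0 t (s / t) I I st01) := delta_ag_convex pf pf pg lf lf lg.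
rewrite mulr0 add0r (divfK t_neq0) (delta_ag_log_interval0 pf pg lf lg).
rewrite mule0 add0e => /le_trans; apply.
rewrite -[leRHS]mul1e lee_wpmul2r//.
- exact: delta_ag_log_interval_ge0.
- by rewrite lee_fin; case/andP: st01.
Qed.

End delta_ag_as_exp_gap.

Theorem proposition3 (R : realType) (f1 f2 f3 : R -> R)
    (psd1 : psd f1) (psd2 : psd f2) (psd3 : psd f3)
    (log1 : log_L1 f1) (log2 : log_L1 f2) (log3 : log_L1 f3) :
  [/\ (0 <= delta_ag f1 f2)%E,
      delta_ag f1 f2 = 0%E <->
        (exists c : R,
          {ae @lebesgue_measure R, forall x, circle x -> f1 x / f2 x = c}),
      forall fb : R -> R, fb = f2 \/ fb = f3 ->
        {in `[0, 1] &, {homo (fun tau : R =>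
          delta_ag f1 (log_interval f1 fb tau)) :
          s t / s <= t >-> (s <= t)%E}}
    & ereal_convex_on `[0, 1]
        (fun tau : R => delta_ag f1 (log_interval f2 f3 tau))].
Proof.
split.
- exact: delta_ag_ge0.
- exact: delta_ag_eq0.
- move=> fb fbE s t; rewrite !in_itv/= => /andP[s0 _] _ st.
  by case: fbE => ->; exact: delta_ag_log_interval_homo.
- by move=> s t l _ _; exact: delta_ag_convex.
Qed.
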